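(* Let $P$ be an $[[N,k,d]]$ stabilizer code with $k\ge 1$, and let $D$ be a local Pauli basis on the $N$ qubits. Then the code distance $d$ is bounded by the coherence of the maximally coherent stabilizer state in the code space: $$d\le C_{PD}\equiv\max_{|\psi\rangle\in P,\ |\psi\rangle\text{ a stabilizer state}} C(|\psi\rangle,D).$$
   Context: $X_i,Y_i,Z_i$ denote the Pauli operators acting on qubit $i$ (identity elsewhere). A Pauli string is a tensor product of single-qubit operators from $\{I,X,Y,Z\}$ with a sign $\pm1$; its weight is the number of sites on which it acts non-trivially. A local Pauli basis $D$ is given by a choice of one Pauli operator $A_i\in\{X_i,Y_i,Z_i\}$ for each site $i$; its basis states are the common eigenvectors $|s\rangle$, $s=(\alpha_1,\dots,\alpha_N)\in\{0,1\}^N$, with $A_i|s\rangle=(-1)^{\alpha_i}|s\rangle$. The relative entropy of coherence of a state $\rho$ in $D$ is $C(\rho,D)=S(\rho_D)-S(\rho)$, where $S(\rho)=-\mathrm{Tr}[\rho\log_2\rho]$ and $\rho_D=\sum_s\langle s|\rho|s\rangle|s\rangle\langle s|$; for a pure state, $C(|\psi\rangle,D)$ is the Shannon entropy (in bits) of the distribution $P(s)=|\langle s|\psi\rangle|^2$. An $[[N,k,d]]$ stabilizer code is a code space $P\subset(\mathbb C^2)^{\otimes N}$ of dimension $2^k$ defined by $N-k$ independent, pairwise commuting signed Pauli strings $g_1,\dots,g_{N-k}$, generating a group $\mathcal S$ not containing $-I$, as $P=\{|\psi\rangle: g_i|\psi\rangle=|\psi\rangle\ \text{for all } i\}$. The code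 distance $d$ is the minimum weight of a Pauli string that commutes with every element of $\mathcal S$ but is not, up to sign, an element of $\mathcal S$. A (pure, normalized) stabilizer state on $N$ qubits is the unique (up to phase) common $+1$ eigenvector of a group of $2^N$ commuting signed Pauli strings not containing $-I$. *)

(* Defs.v *)
From HB Require Import structures.
From mathcomp Require Import all_boot all_order all_algebra.
From mathcomp Require Import spectral sesquilinear.
From mathcomp Require Import complex.
From mathcomp Require Import all_classical all_reals.
From mathcomp Require Import exp.

Set Implicit Arguments.
Unset Strict Implicit.
Unset Printing Implicit Defensive.

Import Order.TTheory GRing.Theory Num.Theory.

Local Open Scope classical_set_scope.
Local Open Scope ring_scope.
Local Open Scope complex_scope.
Local Open Scope sesquilinear_scope.

(* Vectors and operators on (C^2)^{(x)N} are matrices whose row and column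
   indices enumerate the bit strings {0,1}^N, so hdim N = 2 ^ N. *)
Notation bits N := {ffun 'I_N -> 'I_2}.
Notation hdim N := #|{: bits N}|.
Notation ket R N := 'cV[R[i]]_(hdim N).
Notation operator R N := 'M[R[i]]_(hdim N).

Definition tensor_mx (R : realType) (N : nat) (M : 'I_N -> 'M[R[i]]_2) :
    operator R N :=
  \matrix_(x, y) \prod_(i < N) M i ((enum_val x : bits N) i) ((enum_val y : bits N) i).

Inductive pauli := PI | PX | PY | PZ.

Definition pauli_ord (p : pauli) : 'I_4 :=
  inord (match p with PI => 0 | PX => 1 | PY => 2 | PZ => 3 end).

Definition ord_pauli (j : 'I_4) : pauli :=
  match val j with 0 => PI | 1 => PX | 2 => PY | _ => PZ end.

Lemma pauli_ordK : cancel pauli_ord ord_pauli.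
Proof. by case; rewrite /ord_pauli /pauli_ord /= inordK. Qed.

HB.instance Definition _ := Finite.copy pauli (can_type pauli_ordK).

Definition pauli_mx (R : realType) (p : pauli) : 'M[R[i]]_2 :=
  \matrix_(a < 2, b < 2)
    match p with
    | PI => if a == b then 1 else 0
    | PX => if a == b then 0 else 1
    | PY => if a == b then 0 else if a == 0 then - 'i%C else 'i%C
    | PZ => if a == b then (-1) ^+ a else 0
    end.

(* (b, p) stands for the signed string (-1)^b p_1 (x) ... (x) p_N. *)
Definition pauli_string (N : nat) : Type := (bool * {ffun 'I_N -> pauli})%type.

Definition pauli_op (R : realType) (N : nat) (E : pauli_string N) :
    operator R N :=
  (-1) ^+ E.1 *: tensor_mx (fun i => pauli_mx R (E.2 i)).

Definition weight (N : nat) (E : pauli_string N) : nat :=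
  #|[set i | E.2 i != PI]%SET|.

Definition site_pauli (N : nat) (i : 'I_N) (p : pauli) : pauli_string N :=
  (false, [ffun j => if j == i then p else PI]).

Definition mx_group (C : fieldType) (n : nat) (G : set 'M[C]_n) : Prop :=
  [/\ G `<=` [set A | A \in unitmx], G 1%:M,
      forall A B, G A -> G B -> G (A *m B) &
      forall A, G A -> G (invmx A)].

Definition generated (C : fieldType) (n : nat) (X : set 'M[C]_n) : set 'M[C]_n :=
  smallest (@mx_group C n) X.

Definition pauli_generated (R : realType) (N m : nat) (g : 'I_m -> pauli_string N)
    (J : set 'I_m) : set (operator R N) :=
  generated [set pauli_op R (g j) | j in J].

(* Commutes with every element of S but is not, up to sign, in S. *)
Definition logical_string (R : realType) (N : nat) (S : set (operator R N))
    (E : pauli_string N) : Prop :=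
  [/\ forall A, S A -> comm_mx (pauli_op R E) A,
      ~ S (pauli_op R E) & ~ S (- pauli_op R E)].

Definition is_code_distance (R : realType) (N : nat) (S : set (operator R N))
    (d : nat) : Prop :=
  (exists2 E, logical_string S E & weight E = d) /\
  (forall E, logical_string S E -> (d <= weight E)%N).

Record stabilizer_code (R : realType) (N k d : nat) := StabilizerCode {
  code_space : {vspace ket R N};
  code_gen : 'I_(N - k) -> pauli_string N;
  (* N - k is truncated, hence this field. *)
  code_leq : (k <= N)%N;
  code_comm : forall i j,
    comm_mx (pauli_op R (code_gen i)) (pauli_op R (code_gen j));
  code_independent : forall i,
    ~ pauli_generated code_gen [set j | j != i] (pauli_op R (code_gen i));
  code_noN1 : ~ pauli_generated code_gen setT (- 1%:M : operator R N);
  code_spaceP : forall psi : ket R N,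
    psi \in code_space <-> forall i, pauli_op R (code_gen i) *m psi = psi;
  code_dim : \dim code_space = (2 ^ k)%N;
  code_distance :
    is_code_distance (pauli_generated code_gen setT : set (operator R N)) d
}.

Definition normalized (R : realType) (N : nat) (psi : ket R N) : Prop :=
  psi^t* *m psi = 1%:M.

Definition stabilizer_state (R : realType) (N : nat) (psi : ket R N) : Prop :=
  normalized psi /\
  exists G : {set pauli_string N},
    let GO : set (operator R N) := [set pauli_op R E | E in [set` G]] in
    [/\ #|G| = (2 ^ N)%N, mx_group GO,
        forall A B, GO A -> GO B -> comm_mx A B,
        ~ GO (- 1%:M) &
        forall A, GO A -> A *m psi = psi].

(* The basis states are determined up to phases; any choice is allowed. *)
Record local_pauli_basis (R : realType) (N : nat) := LocalPauliBasis {
  basis_pauli : 'I_N -> pauli;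
  basis_ket : bits N -> ket R N;
  basis_pauli_neq : forall i, basis_pauli i != PI;
  basis_normalized : forall s, normalized (basis_ket s);
  basis_eigen : forall s i,
    pauli_op R (site_pauli i (basis_pauli i)) *m basis_ket s
      = (-1) ^+ (s i) *: basis_ket s
}.

(* log2 0 = 0 because ln 0 = 0 in the library; as log2 only enters through
   x * log2 x, this is the usual convention 0 log 0 = 0. *)
Definition log2 (R : realType) (x : R) : R := ln x / ln 2.

(* Spectral calculus, meaningful for Hermitian A (real spectrum). *)
Definition mx_log2 (R : realType) (n : nat) (A : 'M[R[i]]_n) : 'M[R[i]]_n :=
  invmx (spectralmx A)
    *m diag_mx (map_mx (fun z : R[i] => (log2 (complex.Re z))%:C) (spectral_diag A))
    *m spectralmx A.

Definition von_neumann_entropy (R : realType) (n : nat) (rho : 'M[R[i]]_n) : R :=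
  complex.Re (- \tr (rho *m mx_log2 rho)).

Definition dephase (R : realType) (N : nat) (D : local_pauli_basis R N)
    (rho : operator R N) : operator R N :=
  \sum_(s : bits N)
    \tr ((basis_ket D s)^t* *m rho *m basis_ket D s)
      *: (basis_ket D s *m (basis_ket D s)^t*).

Definition coherence (R : realType) (N : nat) (rho : operator R N)
    (D : local_pauli_basis R N) : R :=
  von_neumann_entropy (dephase D rho) - von_neumann_entropy rho.

Definition pure_state (R : realType) (N : nat) (psi : ket R N) : operator R N :=
  psi *m psi^t*.

Definition stabilizer_coherences (R : realType) (N k d : nat)
    (P : stabilizer_code R N k d) (D : local_pauli_basis R N) : set R :=
  [set coherence (pure_state psi) D |
    psi in [set psi | psi \in code_space P /\ stabilizer_state psi]].

Definition is_maximum (R : realType) (A : set R) (m : R) : Prop :=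
  A m /\ ubound A m.

(* Main.v *)
(* Up to phase, Pauli strings form a symplectic vector space over F_2, in which
   the strings T diagonal in D form a Lagrangian subspace. Let S be the
   stabilizer group of the code and r the dimension of S :&: T.

   As dim S < N, some string of T commutes with S without belonging to S up to
   sign. Multiplying it by elements of S :&: T clears r of its sites, so
   d <= N - r.

   On the other hand S extends to a maximal stabilizer group G with
   G :&: T = S :&: T. Its stabilizer state has density matrix
   2^-N \sum_(E in G) E, and only the strings of G :&: T have nonzero expectation
   in a basis state, so every outcome has probability at most 2^(r - N) and the
   coherence is at least N - r. The maximum exists because the density matrix of a
   stabilizer state is determined by its group, of which there are finitely many. *)

Require Import Defs.
From HB Require Import structures.
From mathcomp Require Import all_boot all_order all_algebra.
From mathcomp Require Import spectral sesquilinear complex.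
From mathcomp Require Import all_classical all_reals exp.
From mathcomp Require Import zify lra.

Set Implicit Arguments.
Unset Strict Implicit.
Unset Printing Implicit Defensive.

Import Order.TTheory GRing.Theory Num.Theory.

Local Open Scope ring_scope.
Local Open Scope complex_scope.
Local Open Scope sesquilinear_scope.

(** * Pauli labels, their phases and the commutation form *)

Definition pauli_mul (p q : pauli) : pauli :=
  match p, q with
  | PI, r | r, PI => r
  | PX, PX | PY, PY | PZ, PZ => PI
  | PX, PY | PY, PX => PZ
  | PX, PZ | PZ, PX => PY
  | PY, PZ | PZ, PY => PX
  end.

Lemma pauli_mulA : associative pauli_mul. Proof. by do 3!case. Qed.
Lemma pauli_mulC : commutative pauli_mul. Proof. by do 2!case. Qed.
Lemma pauli_mul1p : left_id PI pauli_mul. Proof. by case. Qed.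
Lemma pauli_mulpp : left_inverse PI id pauli_mul. Proof. by case. Qed.

(* Paulis up to phase form the Klein four-group, written additively so that
   unsigned Pauli strings inherit an additive group of exponent 2. *)
HB.instance Definition _ :=
  GRing.isZmodule.Build pauli pauli_mulA pauli_mulC pauli_mul1p pauli_mulpp.

Notation label N := {ffun 'I_N -> pauli}.

(* Exponent of 'i in the product of two Paulis: X Y = 'i Z and cyclically. *)
Definition pauli_phase (p q : pauli) : nat :=
  match p, q with
  | PX, PY | PY, PZ | PZ, PX => 1
  | PY, PX | PZ, PY | PX, PZ => 3
  | _, _ => 0
  end.

(** The exponent stays an unreduced natural number: its parity decides commutation, and its half,
    when it is even, gives the sign of the product. *)
Definition label_phase N (u v : label N) : nat := \sum_i pauli_phase (u i) (v i).

(** Exchanging two Paulis swaps the exponents 1 and 3, which differ by a factor -1; the parity of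
    the total is therefore the symplectic form over F_2. *)
Definition anticomm N (u v : label N) : bool := odd (label_phase u v).

(** * Symplectic linear algebra over F_2 *)

Section Labels.
Variable N : nat.
Implicit Types (u v w : label N) (W : {set label N}).

Lemma anticommE u v :
  anticomm u v = \big[addb/false]_i odd (pauli_phase (u i) (v i)).
Proof. by rewrite /anticomm /label_phase (big_morph odd oddD (erefl _)). Qed.

Lemma anticommC u v : anticomm u v = anticomm v u.
Proof. by rewrite !anticommE; apply: eq_bigr => i _; case: (u i); case: (v i). Qed.

Lemma anticommDr u v w : anticomm u (v + w) = anticomm u v (+) anticomm u w.
Proof.
rewrite !anticommE -big_split; apply: eq_bigr => i _; rewrite ffunE.
by case: (u i); case: (v i); case: (w i).
Qed.

Lemma anticommDl u v w : anticomm (u + v) w = anticomm u w (+) anticomm v w.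
Proof. by rewrite anticommC anticommDr !(anticommC w). Qed.

Lemma anticomm0 u : anticomm u 0 = false.
Proof.
by rewrite anticommE big1 // => i _; rewrite ffunE; case: (u i).
Qed.

Lemma anticomm0l u : anticomm 0 u = false.
Proof. by rewrite anticommC anticomm0. Qed.

Lemma label_phaseuu u : label_phase u u = 0.
Proof. by apply: big1 => i _; case: (u i). Qed.

Lemma anticommuu u : anticomm u u = false.
Proof. by rewrite /anticomm label_phaseuu. Qed.

Lemma labelDD u v : u + (u + v) = v.
Proof. by apply/ffunP=> i; rewrite !ffunE; case: (u i); case: (v i). Qed.

Lemma labeluu u : u + u = 0.
Proof. by rewrite -[X in _ + X]addr0 labelDD. Qed.

Lemma label_add_eq0 u v : (u + v == 0) = (u == v).
Proof. by rewrite -(inj_eq (addrI u)) labelDD addr0 eq_sym. Qed.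

Lemma anticomm_site i p u :
  anticomm u (site_pauli i p).2 = odd (pauli_phase (u i) p).
Proof.
rewrite anticommE (bigD1 i) //= ffunE eqxx big1 ?addbF // => j /negPf ji.
by rewrite ffunE ji; case: (u j).
Qed.

Lemma anticomm_nondeg u : u != 0 -> exists v, anticomm v u.
Proof.
move=> u0; have [i ui] : exists i, u i != PI.
  apply/existsP; apply: contraNT u0 => /existsPn u0.
  by apply/eqP/ffunP=> i; rewrite ffunE; apply/eqP/negPn.
(* Any nontrivial Pauli other than [u i] anticommutes with [u i]. *)
exists (site_pauli i (if u i is PX then PY else PX)).2.
by rewrite anticommC anticomm_site; case: (u i) ui; rewrite ?eqxx.
Qed.

Lemma card_label : #|{: label N}| = (4 ^ N)%N.
Proof.
rewrite card_ffun card_ord; congr (_ ^ _)%N.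
by rewrite -[RHS]card_ord (bij_eq_card (f := pauli_ord)) //;
  exists ord_pauli; [exact: pauli_ordK|];
  case=> [[|[|[|[|]]]]] // ?; apply/val_inj; rewrite /= inordK.
Qed.

Definition subspace W : Prop := 0 \in W /\ {in W &, forall u v, u + v \in W}.

Definition perp W : {set label N} :=
  [set u | [forall w in W, ~~ anticomm u w]].

Lemma perpP W u : reflect {in W, forall w, ~~ anticomm u w} (u \in perp W).
Proof. by rewrite inE; apply: (iffP forall_inP). Qed.

Lemma perpS W1 W2 : W1 \subset W2 -> perp W2 \subset perp W1.
Proof.
by move=> /fintype.subsetP s; apply/fintype.subsetP=> u /perpP uW; apply/perpP=> w /s /uW.
Qed.

Lemma perp_subspace W : subspace (perp W).
Proof.
split; first by apply/perpP => w _; rewrite anticomm0l.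
move=> u v /perpP uW /perpP vW; apply/perpP => w wW.
by rewrite anticommDl (negPf (uW w wW)) (negPf (vW w wW)).
Qed.

Lemma sub_perp_perp W : W \subset perp (perp W).
Proof.
apply/fintype.subsetP=> w wW; apply/perpP=> u /perpP /(_ w wW).
by rewrite anticommC.
Qed.

(** Orthogonality of characters: translation by [a] permutes [W] and flips every sign. *)
Lemma sum_signs_eq0 (W : {set label N}) (f : label N -> bool) a :
    {in W &, forall u v, u + v \in W} -> {morph f : u v / u + v >-> u (+) v} ->
    a \in W -> f a ->
  \sum_(w in W) (-1) ^+ f w = 0 :> int.
Proof.
move=> WD fD aW fa.
have : \sum_(w in W) (-1) ^+ f w = - \sum_(w in W) (-1) ^+ f w :> int.
  rewrite {1}(reindex_inj (addrI a)) /= -sumrN; apply: eq_big => [w|w _].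
    by apply/idP/idP => [/(WD _ _ aW)|/(WD _ _ aW) //]; rewrite labelDD.
  by rewrite fD fa addTb signrN.
lia.
Qed.

(** The signs [(-1) ^+ anticomm u w] are summed in two ways. A fixed [u] contributes [#|W|] if it
    lies in [perp W] and 0 otherwise; a fixed [w] contributes [4 ^ N] if it is 0 and, by
    nondegeneracy, 0 otherwise. *)
Lemma card_perp W : subspace W -> (#|W| * #|perp W|)%N = (4 ^ N)%N.
Proof.
move=> [W0 WD].
pose s : int := \sum_u \sum_(w in W) (-1) ^+ anticomm u w.
have s1 : s = (#|W| * #|perp W|)%N.
  rewrite /s (bigID (mem (perp W))) /= [X in _ + X]big1 ?addr0.
    rewrite (eq_bigr (fun=> #|W|%:Z)).
      by rewrite sumr_const mulnC -mulr_natr natz PoszM mulrC.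
    move=> u /perpP uW; rewrite (eq_bigr (fun=> 1)) ?sumr_const ?natz//.
    by move=> w /uW /negPf ->.
  move=> u; rewrite inE negb_forall => /existsP [w].
  rewrite negb_imply negbK => /andP [wW uw].
  by apply: (sum_signs_eq0 WD _ wW uw) => v1 v2; rewrite anticommDr.
have s2 : s = (4 ^ N)%N.
  rewrite /s exchange_big /= (bigD1 (0 : label N)) //= [X in _ + X]big1 ?addr0.
    rewrite (eq_bigr (fun=> 1)) => [|u _]; last by rewrite anticomm0.
    by rewrite sumr_const card_label natz.
  move=> w /andP [_ /anticomm_nondeg [v vw]].
  rewrite -[RHS](@sum_signs_eq0 [set: label N]%SET (fun u => anticomm u w) v) //.
  - by apply: eq_bigl => u; rewrite inE.
  - by move=> v1 v2 _ _; rewrite inE.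
  - by move=> v1 v2; rewrite anticommDl.
by apply/eqP; rewrite -eqz_nat -s1 s2.
Qed.

Lemma perpK W : subspace W -> perp (perp W) = W.
Proof.
move=> sW; apply/esym/eqP; rewrite eqEcard sub_perp_perp /=.
have pos : (0 < #|perp W|)%N by apply/card_gt0P; exists 0; case: (perp_subspace W).
by rewrite -(leq_pmul2l pos) card_perp 1?mulnC ?card_perp //; exact: perp_subspace.
Qed.

Lemma isotropic_card W : subspace W -> W \subset perp W -> (#|W| <= 2 ^ N)%N.
Proof.
move=> sW /subset_leq_card Wp; rewrite -leq_sqr -expnM mulnC expnM -(card_perp sW).
by rewrite -mulnn leq_mul2l Wp orbT.
Qed.

Definition sumset W1 W2 : {set label N} := [set u + v | u : label N in W1, v : label N in W2].

Lemma sumset_subspace W1 W2 :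
  subspace W1 -> subspace W2 -> subspace (sumset W1 W2).
Proof.
move=> [z1 D1] [z2 D2]; split.
  by apply/imset2P; exists (0 : label N) (0 : label N); rewrite ?addr0.
move=> _ _ /imset2P [u v uW vW ->] /imset2P [u' v' uW' vW' ->].
by rewrite addrACA; apply: imset2_f; [apply: D1|apply: D2].
Qed.

Lemma sumset_subl W1 W2 : subspace W2 -> W1 \subset sumset W1 W2.
Proof.
by move=> [z _]; apply/fintype.subsetP=> u uW; apply/imset2P; exists u (0 : label N); rewrite ?addr0.
Qed.

Lemma sumset_subr W1 W2 : subspace W1 -> W2 \subset sumset W1 W2.
Proof.
by move=> [z _]; apply/fintype.subsetP=> u uW; apply/imset2P; exists (0 : label N) u; rewrite ?add0r.
Qed.

(* Otherwise perp W would lie in W + T and hence be isotropic, although it has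
   more than 2 ^ N elements. *)
Lemma perp_not_sub_sumset W T :
    subspace W -> W \subset perp W -> (#|W| < 2 ^ N)%N ->
    subspace T -> T \subset perp T ->
  exists2 p, p \in perp W & p \notin sumset W T.
Proof.
move=> sW /fintype.subsetP iW cW sT /fintype.subsetP iT; apply/subsetPn/negP=> /fintype.subsetP sub.
have [_ pD] := perp_subspace W.
(* The [T] component stays in [perp W] because [W] is isotropic, so all four pairings between two
   such decompositions vanish. *)
have T_part u : u \in perp W -> exists w t,
    [/\ w \in W, t \in T, t \in perp W & u = w + t].
  move=> up; have /imset2P [w t wW tT def_u] := sub u up.
  exists w, t; split=> //; rewrite -(labelDD w t) -def_u; apply: pD => //.
  exact: iW.
have : perp W \subset perp (perp W).
  apply/fintype.subsetP=> _ /T_part [w [t [wW tT tp ->]]].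
  apply/perpP => _ /T_part [w' [t' [wW' tT' tp' ->]]].
  have /negPf ww' : ~~ anticomm w w' by move/iW/perpP: wW; apply.
  have /negPf wt' : ~~ anticomm w t' by rewrite anticommC; move/perpP: tp'; apply.
  have /negPf tw' : ~~ anticomm t w' by move/perpP: tp; apply.
  have /negPf tt' : ~~ anticomm t t' by move/iT/perpP: tT; apply.
  by rewrite !anticommDl !anticommDr ww' wt' tw' tt'.
move/(isotropic_card (perp_subspace W)) => le2.
have := card_perp sW; have -> : (4 ^ N = 2 ^ N * 2 ^ N)%N by rewrite -expnMn.
by nia.
Qed.

(** Take [p] in [perp W] outside [W + T]. As [W + T] is its own double complement, some [t]
    orthogonal to [W + T] anticommutes with [p]. Then [t] lies in [perp T = T], and not in [W],
    since [p] commutes with [W]. *)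
Lemma cap_perp_not_sub W T :
    subspace W -> W \subset perp W -> (#|W| < 2 ^ N)%N ->
    subspace T -> perp T = T ->
  exists t, [/\ t \in T, t \in perp W & t \notin W].
Proof.
move=> sW iW cW sT pT.
have [|p pW pWT] := perp_not_sub_sumset sW iW cW sT _; first by rewrite pT.
have sU := sumset_subspace sW sT.
have : p \notin perp (perp (sumset W T)) by rewrite perpK.
rewrite inE negb_forall => /existsP [t]; rewrite negb_imply negbK => /andP [tU pt].
exists t; split.
- by rewrite -pT; apply: (fintype.subsetP (perpS (sumset_subr _ sW))).
- exact: (fintype.subsetP (perpS (sumset_subl _ sT))).
- by apply: contraL pt => tW; move/perpP: pW; apply.
Qed.

End Labels.


(** * Pauli strings as operators *)

Section PauliOperators.
Variables (R : realType) (N : nat).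
Implicit Types (u v : label N) (E F G : pauli_string N) (M : 'I_N -> 'M[R[i]]_2).

Lemma pauli_mxM (p q : pauli) :
  pauli_mx R p *m pauli_mx R q = 'i%C ^+ pauli_phase p q *: pauli_mx R (p + q).
Proof.
apply/matrixP=> a b; rewrite !mxE !big_ord_recl big_ord0 !mxE addr0.
have ii : 'i%C * 'i%C = -1 :> R[i] by rewrite -expr2 sqr_i.
(* Once ['i] is abstracted, the entries are compared using [ci * ci = -1] alone. *)
move: ('i%C : R[i]) ii => ci ii.
have i3 : ci ^+ 3 = - ci by rewrite !exprS expr0 mulr1 ii mulrN1.
case: p; case: q; case: a => [[|[|]]] // ?; case: b => [[|[|]]] // ?;
  rewrite /= ?i3 ?expr0 ?expr1;
  by rewrite ?(mul0r, mulr0, mul1r, mulr1, add0r, addr0, mulNr, mulrN, ii, opprK).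
Qed.

Lemma pauli_mx_adj (p : pauli) : (pauli_mx R p)^t* = pauli_mx R p.
Proof.
apply/matrixP=> a b; rewrite !mxE.
by case: p; case: a => [[|[|]]] // ?; case: b => [[|[|]]] // ?;
  rewrite ?rmorphN ?rmorphXn ?rmorph1 ?rmorph0 //=;
  apply/eqP; rewrite eq_complex /= ?oppr0 ?opprK ?eqxx.
Qed.

Lemma pauli_mx_tr (p : pauli) : \tr (pauli_mx R p) = if p == PI then 2 else 0.
Proof.
rewrite /mxtrace !big_ord_recl big_ord0 !mxE.
case: (eqVneq p PI) => [->|]; first by rewrite /= addr0.
by case: p => /= [/eqP//|||] _; rewrite ?expr0 ?expr1 ?addr0 ?subrr.
Qed.

Lemma tensor_mxM M1 M2 :
  tensor_mx M1 *m tensor_mx M2 = tensor_mx (fun i => M1 i *m M2 i).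
Proof.
apply/matrixP=> x y; rewrite !mxE.
under [RHS]eq_bigr do rewrite mxE.
rewrite bigA_distr_bigA /= (reindex (@enum_val _ (mem {: bits N}))) /=; last first.
  by apply: onW_bij; exact: enum_val_bij.
by apply: eq_bigr => z _; rewrite !mxE -big_split.
Qed.

Lemma tensor_mxZ (c : 'I_N -> R[i]) M :
  tensor_mx (fun i => c i *: M i) = (\prod_i c i) *: tensor_mx M.
Proof.
by apply/matrixP=> x y; rewrite !mxE -big_split; apply: eq_bigr => i _; rewrite mxE.
Qed.

Lemma tensor_mx_tr M : \tr (tensor_mx M) = \prod_i \tr (M i).
Proof.
rewrite /mxtrace bigA_distr_bigA /=.
rewrite [RHS](reindex (@enum_val _ (mem {: bits N}))) /=; last first.
  by apply: onW_bij; exact: enum_val_bij.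
by apply: eq_bigr => z _; rewrite !mxE.
Qed.

Lemma eq_tensor_mx M1 M2 : M1 =1 M2 -> tensor_mx M1 = tensor_mx M2.
Proof.
by move=> e; apply/matrixP=> x y; rewrite !mxE; apply: eq_bigr => i _; rewrite e.
Qed.

Lemma tensor_mx_adj M : (tensor_mx M)^t* = tensor_mx (fun i => (M i)^t*).
Proof.
apply/matrixP=> x y; rewrite !mxE rmorph_prod /=.
by apply: eq_bigr => i _; rewrite !mxE.
Qed.

Lemma pauli_op_phaseM E F :
  pauli_op R E *m pauli_op R F =
  ((-1) ^+ (E.1 (+) F.1) * 'i%C ^+ label_phase E.2 F.2)
    *: pauli_op R (false, E.2 + F.2).
Proof.
rewrite /pauli_op expr0 scale1r -scalemxAl -scalemxAr scalerA -signr_addb.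
rewrite tensor_mxM /=.
rewrite (eq_tensor_mx (fun i => pauli_mxM _ _)) tensor_mxZ scalerA.
congr (_ * _ *: _); first by rewrite /label_phase expr_sum.
by apply: eq_tensor_mx => i; rewrite ffunE.
Qed.

(** Meaningful for commuting factors: their phase exponent is some even [2 * m], and
    ['i ^+ (2 * m) = (-1) ^+ m]. *)
Definition string_mul E F : pauli_string N :=
  (E.1 (+) F.1 (+) odd (label_phase E.2 F.2)./2, E.2 + F.2).

Lemma pauli_opM E F : ~~ anticomm E.2 F.2 ->
  pauli_op R E *m pauli_op R F = pauli_op R (string_mul E F).
Proof.
move=> ac; rewrite pauli_op_phaseM /pauli_op /= expr0 scale1r.
rewrite [in RHS]signr_addb; congr (_ * _ *: _).
rewrite -{1}[label_phase _ _]odd_double_half -/(anticomm _ _) (negPf ac) add0n -mul2n exprM sqr_i.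
by rewrite signr_odd.
Qed.

Lemma pauli_op_anticomm E F :
  pauli_op R F *m pauli_op R E =
  (-1) ^+ anticomm E.2 F.2 *: (pauli_op R E *m pauli_op R F).
Proof.
rewrite !pauli_op_phaseM scalerA mulrCA [F.2 + _]addrC addbC.
congr (_ * _ *: _); rewrite /label_phase !expr_sum anticommE.
rewrite (big_morph _ (@signr_addb _) (erefl _)) -big_split.
apply: eq_bigr => i _ /=.
have i2 : 'i%C ^+ 2 = -1 :> R[i] := sqr_i R.
by case: (E.2 i); case: (F.2 i); rewrite /= ?mul1r // [_ ^+ 3]exprSr i2 ?expr1 ?mulN1r ?opprK.
Qed.

Lemma pauli_op_adj E : (pauli_op R E)^t* = pauli_op R E.
Proof.
rewrite /pauli_op linearZ /= map_mxZ tensor_mx_adj rmorph_sign; congr (_ *: _).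
by apply: eq_tensor_mx => i; rewrite pauli_mx_adj.
Qed.

Lemma pauli_op_tr E :
  \tr (pauli_op R E) = if E.2 == 0 then (-1) ^+ E.1 * 2 ^+ N else 0.
Proof.
rewrite /pauli_op linearZ /= tensor_mx_tr.
case: (eqVneq E.2 0) => [->|/eqP E0].
  rewrite (eq_bigr (fun=> 2)) ?prodr_const ?card_ord // => i _.
  by rewrite ffunE pauli_mx_tr eqxx.
have [i Ei] : exists i, E.2 i != PI.
  apply/existsP; apply: contra_notT E0 => /existsPn E0.
  by apply/ffunP=> i; rewrite ffunE; apply/eqP/negPn.
by rewrite (bigD1 i) //= pauli_mx_tr (negPf Ei) mul0r mulr0.
Qed.

Lemma pauli_op_trM E F : \tr (pauli_op R E *m pauli_op R F) =
  if E.2 == F.2 then (-1) ^+ (E.1 (+) F.1) * 2 ^+ N else 0.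
Proof.
rewrite pauli_op_phaseM linearZ /= pauli_op_tr /= label_add_eq0.
case: eqP => [->|_]; rewrite ?mulr0 // expr0 mul1r.
by rewrite label_phaseuu expr0 mulr1.
Qed.

(** Trace orthogonality: the trace of a product of two strings is nonzero only for equal labels, and
    then tells whether the signs agree. *)
Lemma pauli_op_inj : injective (@pauli_op R N).
Proof.
move=> E F eEF; have := pauli_op_trM E E; rewrite {2}eEF pauli_op_trM eqxx addbb.
have n0 : (2 ^+ N : R[i]) != 0 by rewrite expf_neq0 // pnatr_eq0.
case: eqP => [e2|_] /eqP; last by rewrite expr0 mul1r eq_sym (negPf n0).
rewrite (inj_eq (mulIf n0)) => /eqP/signr_inj/esym.
by case: E F e2 {eEF} => [a u] [b v] /= ->; case: a b => [] [].
Qed.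

Lemma pauli_op1 : pauli_op R (false, 0) = 1%:M :> operator R N.
Proof.
rewrite /pauli_op expr0 scale1r; apply/matrixP=> x y; rewrite !mxE.
case: (eqVneq x y) => [->|].
  by apply: big1 => i _; rewrite !mxE ffunE eqxx.
rewrite -(inj_eq enum_val_inj) => xy; apply/eqP/prodf_eq0.
have [i xyi] : exists i, (enum_val x : bits N) i != (enum_val y : bits N) i.
  apply/existsP; apply: contraNT xy => /existsPn xy.
  by apply/eqP/ffunP=> i; apply/eqP/negPn.
by exists i => //; rewrite mxE ffunE (negPf xyi).
Qed.

Lemma pauli_opN b u : pauli_op R (~~ b, u) = - pauli_op R (b, u).
Proof. by rewrite /pauli_op /= signrN scaleNr. Qed.

Lemma pauli_op_sqr E : pauli_op R E *m pauli_op R E = 1%:M.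
Proof.
rewrite pauli_opM ?anticommuu // /string_mul addbb label_phaseuu labeluu.
exact: pauli_op1.
Qed.

Lemma pauli_op_unit E : pauli_op R E \in unitmx.
Proof. by case/mulmx1_unit: (pauli_op_sqr E). Qed.

Lemma pauli_op_inv E : invmx (pauli_op R E) = pauli_op R E.
Proof.
by rewrite -[LHS]mulmx1 -(pauli_op_sqr E) mulmxA mulVmx ?pauli_op_unit // mul1mx.
Qed.

(** If an anticommuting pair also commuted, cancelling both involutions would give [1 = -1], which
    the trace refutes. *)
Lemma pauli_op_comm E F :
  comm_mx (pauli_op R E) (pauli_op R F) <-> ~~ anticomm E.2 F.2.
Proof.
rewrite /comm_mx (pauli_op_anticomm E F); case: anticomm; last by rewrite scale1r.
split=> // /(congr1 (mulmx^~ (pauli_op R F))).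
rewrite expr1 scaleN1r mulNmx -mulmxA pauli_op_sqr mulmx1.
move/(congr1 (mulmx^~ (pauli_op R E))); rewrite mulNmx pauli_op_sqr.
move/(congr1 mxtrace); rewrite linearN /= -pauli_op1 pauli_op_tr eqxx expr0 mul1r.
move/eqP; rewrite -subr_eq0 opprK -mulr2n mulrn_eq0 /= expf_eq0 pnatr_eq0.
by rewrite andbF.
Qed.

End PauliOperators.

(** * Stabilizer groups as finite sets of signed strings *)

Definition stab_group N (G : {set pauli_string N}) : Prop :=
  [/\ (false, 0) \in G, (true, 0) \notin G,
      {in G &, forall E F, ~~ anticomm E.2 F.2} &
      {in G &, forall E F, string_mul E F \in G}].

Definition labels N (G : {set pauli_string N}) : {set label N} :=
  [set E.2 | E : pauli_string N in G].

(** The subspace of strings diagonal in the local basis [a]; it is Lagrangian when no [a i] is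
    [PI]. *)
Definition basis_labels N (a : 'I_N -> pauli) : {set label N} :=
  [set u : label N | [forall i, (u i == PI) || (u i == a i)]].

Section StabilizerGroups.
Variables (R : realType) (N : nat).
Implicit Types (u v : label N) (E F H : pauli_string N) (G S : {set pauli_string N}).

(** The laws of [string_mul] on commuting strings are pulled back from matrix multiplication along
    [pauli_op_inj], which avoids computing with halved exponents. *)
Lemma string_mulC E F : ~~ anticomm E.2 F.2 -> string_mul E F = string_mul F E.
Proof.
move=> EF; apply: (@pauli_op_inj R).
have FE : ~~ anticomm F.2 E.2 by rewrite anticommC.
by rewrite -(pauli_opM _ EF) -(pauli_opM _ FE); exact/pauli_op_comm.
Qed.

Lemma string_mulA E F H :
    ~~ anticomm E.2 F.2 -> ~~ anticomm F.2 H.2 -> ~~ anticomm E.2 H.2 ->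
  string_mul (string_mul E F) H = string_mul E (string_mul F H).
Proof.
move=> EF FH EH; apply: (@pauli_op_inj R).
by rewrite -!pauli_opM ?mulmxA //= ?anticommDr ?anticommDl ?(negPf EF) ?(negPf EH).
Qed.

Lemma string_mulK E F : ~~ anticomm E.2 F.2 -> string_mul E (string_mul E F) = F.
Proof.
move=> EF; apply: (@pauli_op_inj R).
rewrite -!pauli_opM //= ?anticommDr ?anticommuu // mulmxA pauli_op_sqr.
by rewrite mul1mx.
Qed.

Lemma labelsP G u : reflect (exists2 E, E \in G & u = E.2) (u \in labels G).
Proof. exact: imsetP. Qed.

(** The product of the two strings is [(b (+) c, 0)], so different signs would put [(true, 0)] in
    [G]. *)
Lemma stab_group_sign G b c u :
  stab_group G -> (b, u) \in G -> (c, u) \in G -> b = c.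
Proof.
move=> [_ /negP n1 _ GM] bG cG; have := GM _ _ bG cG.
by rewrite /string_mul /= label_phaseuu labeluu; case: b c {bG cG} => [] [].
Qed.

Lemma labels_subspace G : stab_group G -> subspace (labels G).
Proof.
move=> [G1 _ _ GM]; split; first by apply/labelsP; exists (false, 0).
move=> _ _ /labelsP [E EG ->] /labelsP [F FG ->].
by apply/labelsP; exists (string_mul E F); rewrite ?GM.
Qed.

Lemma labels_isotropic G : stab_group G -> labels G \subset perp (labels G).
Proof.
move=> [_ _ GC _]; apply/fintype.subsetP => _ /labelsP [E EG ->].
by apply/perpP => _ /labelsP [F FG ->]; apply: GC.
Qed.

Lemma card_labels G : stab_group G -> #|labels G| = #|G|.
Proof.
move=> sG; rewrite card_in_imset // => -[b u] [c v] /= bG cG uv.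
by rewrite uv in bG *; rewrite (stab_group_sign sG bG cG).
Qed.

Lemma stab_group_card G : stab_group G -> (#|G| <= 2 ^ N)%N.
Proof.
move=> sG; rewrite -card_labels //.
by apply: isotropic_card; [apply: labels_subspace|apply: labels_isotropic].
Qed.

(** The coset is that of an involution commuting with [G], so the union is closed under products. As
    [p] is not a label of [G], no string of the coset has label 0, which keeps [(true, 0)] out. *)
Lemma stab_group_extend G p :
    stab_group G -> p \in perp (labels G) -> p \notin labels G ->
  stab_group (G :|: [set string_mul (false, p) E | E : pauli_string N in G]).
Proof.
move=> [G1 N1 GC GM] /perpP pG npG; set E0 := (false, p).
have cG E : E \in G -> ~~ anticomm E0.2 E.2.
  by move=> EG; apply: pG; apply/labelsP; exists E.
have cG' E F : E \in G -> F \in G -> ~~ anticomm E.2 (string_mul E0 F).2.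
  move=> EG FG; rewrite /= anticommDr (negPf (GC _ _ EG FG)) anticommC.
  by rewrite (negPf (cG E EG)).
have m1 E F : E \in G -> F \in G ->
    string_mul (string_mul E0 E) F = string_mul E0 (string_mul E F).
  by move=> EG FG; rewrite string_mulA ?cG ?GC.
split.
- by rewrite inE G1.
- rewrite inE (negPf N1); apply: contra npG => /imsetP [E EG [_ /esym/eqP]].
  by rewrite label_add_eq0 => /eqP ->; apply/labelsP; exists E.
- move=> A B; rewrite !inE => /orP [AG|/imsetP [A' A'G ->]]
    /orP [BG|/imsetP [B' B'G ->]].
  + exact: GC.
  + exact: cG'.
  + by rewrite anticommC; exact: cG'.
  + rewrite [X in anticomm X _]/= anticommDl (negPf (cG' _ _ A'G B'G)) addbF.
    by change (~~ anticomm p (p + B'.2)); rewrite anticommDr anticommuu; exact: cG.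
move=> A B; rewrite !inE => /orP [AG|/imsetP [A' A'G ->]]
  /orP [BG|/imsetP [B' B'G ->]].
- by rewrite GM.
- apply/orP; right; rewrite string_mulC ?cG' // m1 //.
  by apply/imsetP; exists (string_mul B' A); rewrite ?GM.
- apply/orP; right; rewrite m1 //.
  by apply/imsetP; exists (string_mul A' B); rewrite ?GM.
- rewrite [string_mul E0 A']string_mulC ?cG // string_mulA.
  + by rewrite string_mulK ?cG // GM.
  + by rewrite anticommC cG.
  + by change (~~ anticomm p (p + B'.2)); rewrite anticommDr anticommuu; exact: cG.
  + exact: cG'.
Qed.

(** [G] is taken maximal with the last property. If it had fewer than [2 ^ N] elements,
    [perp_not_sub_sumset] would give a [p] by which it can be extended. *)
Lemma stab_group_complete S (T : {set label N}) :
    stab_group S -> subspace T -> T \subset perp T ->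
  exists G, [/\ S \subset G, stab_group G, #|G| = (2 ^ N)%N &
    {in G, forall E, E.2 \in T -> E \in S}].
Proof.
move=> sS sT iT.
pose P G := `[< stab_group G /\ {in G, forall E, E.2 \in T -> E \in S} >].
have [G /maxsetP [/asboolP [sG GT] Gmax] SG] : {G | maxset P G & S \subset G}.
  by apply: maxset_exists; apply/asboolP; split=> // E ->.
exists G; split=> //; apply/eqP; rewrite eqn_leq stab_group_card //= leqNgt.
apply/negP; rewrite -card_labels // => ltG.
have [p pG pGT] := perp_not_sub_sumset (labels_subspace sG)
  (labels_isotropic sG) ltG sT iT.
have npG : p \notin labels G.
  by apply: contra pGT; apply/fintype.subsetP/sumset_subl.
have [G1 _ _ _] := sG.
set G' := G :|: [set string_mul (false, p) E | E : pauli_string N in G].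
have eG' : G' = G.
  apply: Gmax; last exact: finset.subsetUl.
  apply/asboolP; split; first exact: (stab_group_extend sG pG npG).
  move=> E; rewrite inE => /orP [|/imsetP [F FG ->]]; first exact: GT.
  (* A string of the new coset labelled in [T] would place [p = F.2 + (p + F.2)] in
     [labels G + T]. *)
  move=> /= pFT; case/negP: pGT; apply/imset2P; exists F.2 (p + F.2) => //.
    by apply/labelsP; exists F.
  by rewrite addrC -addrA labeluu addr0.
have : string_mul (false, p) (false, 0) \in G.
  by rewrite -eG' inE; apply/orP; right; apply: imset_f.
by move=> pG'; case/negP: npG; apply/labelsP; eexists; first exact: pG'; rewrite /= addr0.
Qed.

Lemma basis_labelsP (a : 'I_N -> pauli) u :
  reflect (forall i, u i = PI \/ u i = a i) (u \in basis_labels a).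
Proof.
rewrite inE; apply: (iffP forallP) => ua i.
  by case/orP: (ua i) => /eqP; [left|right].
by apply/orP; case: (ua i) => ->; [left|right].
Qed.

Lemma basis_labels_subspace (a : 'I_N -> pauli) : subspace (basis_labels a).
Proof.
split; first by apply/basis_labelsP=> i; left; rewrite ffunE.
move=> u v /basis_labelsP ua /basis_labelsP va; apply/basis_labelsP => i.
rewrite ffunE; case: (ua i) (va i) => -> [] ->; rewrite ?add0r ?addr0; auto.
by left; case: (a i).
Qed.

(** Commuting with the one-site string [a i] forces [u i] to be [PI] or [a i]. *)
Lemma basis_labels_perp (a : 'I_N -> pauli) :
  (forall i, a i != PI) -> perp (basis_labels a) = basis_labels a.
Proof.
move=> a0; apply/setP => u; apply/perpP/basis_labelsP => [uT i|ua v /basis_labelsP va].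
  have : ~~ anticomm u (site_pauli i (a i)).2.
    apply/uT/basis_labelsP => j; rewrite ffunE.
    by case: eqP => [->|_]; auto.
  rewrite anticomm_site.
  by case: (u i); case: (a i) (a0 i) => //=; rewrite ?eqxx; auto.
rewrite anticommE big1 // => i _; case: (ua i) (va i) => -> [] ->;
  by case: (a i).
Qed.

(* Let u be an element of least weight in the coset t + (S :&: T). An element of
   S :&: T supported inside the support of u could be added to u, lowering its
   weight; so the elements of S :&: T are determined by their supports outside
   the support of u. *)
Lemma card_diag_stab S (a : 'I_N -> pauli) (d : nat) :
    (forall i, a i != PI) -> stab_group S -> (#|S| < 2 ^ N)%N ->
    (forall u, u \in perp (labels S) -> u \notin labels S ->
      (d <= weight (false, u))%N) ->
  (#|[set E in S | E.2 \in basis_labels a]| * 2 ^ d <= 2 ^ N)%N.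
Proof.
move=> a0 sS ltS dist; set T := basis_labels a; set B := [set E in S | _].
have sT : subspace T := basis_labels_subspace a.
have [S1 _ SC SM] := sS; have [sW iW] := (labels_subspace sS, labels_isotropic sS).
have ltW : (#|labels S| < 2 ^ N)%N by rewrite card_labels.
(* The whole coset of [t] consists of diagonal labels of logical strings, so [dist] will apply to
   its lightest element. *)
have [t [tT tp ntS]] := cap_perp_not_sub sW iW ltW sT (basis_labels_perp a0).
have BP E : E \in B <-> E \in S /\ E.2 \in T.
  by rewrite finset.in_set; split=> /andP.
have BM : {in B &, forall E F, string_mul E F \in B}.
  move=> E F /BP [ES ET] /BP [FS FT].
  by apply/BP; split; [exact: SM | exact: sT.2].
have B1 : (false, 0) \in B by apply/BP; split=> //; exact: sT.1.
have BS E : E \in B -> E.2 \in labels S.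
  by case/BP=> ES _; apply/labelsP; exists E.
pose wt E := weight (false, t + E.2).
case: (arg_minnP wt B1) => E0 E0B minE0; set u := t + E0.2.
have [_ pD] := perp_subspace (labels S).
have up : u \in perp (labels S).
  by apply: pD => //; apply: (fintype.subsetP iW); apply: BS.
have nuS : u \notin labels S.
  apply: contra ntS => uS.
  by rewrite -[t](labelDD E0.2) [E0.2 + t]addrC sW.2 ?BS.
pose supp v := [set i | v i != PI]%SET.
have led : (d <= #|supp u|)%N by exact: dist.
have uT : u \in T by rewrite sT.2 //; case/BP: E0B.
have injB : {in B &, injective (fun E => supp E.2 :\: supp u)}.
  move=> E F EB FB /setP eEF; have HB := BM _ _ EB FB.
  (* Off the support of [u], both labels take values in [PI] and [a i] and have the same support,
     hence agree. *)
  have supEF i : u i = PI -> E.2 i = F.2 i.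
    move=> ui; have := eEF i; rewrite !inE ui eqxx /=.
    case/BP: EB => _ /basis_labelsP ET; case/BP: FB => _ /basis_labelsP FT.
    by case: (ET i) (FT i) => -> [] -> //; rewrite !eqxx (a0 i).
  have : (wt E0 <= wt (string_mul E0 (string_mul E F)))%N by apply/minE0/BM.
  rewrite /wt addrA -/u; clearbody u => {E0 minE0 E0B}; rewrite leqNgt; apply: contraNeq => neEF.
  have [b u'] : exists i, E.2 i != F.2 i.
    apply/existsP; apply: contraNT neEF => /existsPn eq2.
    have e2 : E.2 = F.2 by apply/ffunP=> i; apply/eqP/negPn.
    case: E F e2 EB FB {eEF supEF HB eq2} => [b v] [c w] /= <- /BP [ES _] /BP [FS _].
    by rewrite (stab_group_sign sS ES FS).
  (* Where [E] and [F] differ, the label of their product is that of [u], so the site leaves the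
     support of the sum. *)
  have sumPI (x y z : pauli) : y = PI \/ y = x -> z = PI \/ z = x ->
      y != z -> x + (y + z) = PI.
    by case=> -> [] ->; rewrite ?eqxx // ?add0r ?addr0; case: x.
  apply/proper_card/fintype.properP; split.
    apply/fintype.subsetP => i; rewrite !inE /= !ffunE; apply: contra => /eqP ui.
    by rewrite ui (supEF i ui) add0r; case: (F.2 i); rewrite eqxx.
  exists b; rewrite !inE /= ?ffunE.
    by apply: contra u' => /eqP/supEF ->.
  case/BP: EB => _ /basis_labelsP /(_ b) ET; case/BP: FB => _ /basis_labelsP /(_ b) FT.
  have /basis_labelsP /(_ b) [ub|ub] := uT; first by rewrite supEF ?eqxx in u'.
  have := sumPI _ _ _ ET FT u'; rewrite -ub => ->.
  by rewrite eqxx.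
(* At most [2 ^ (N - #|supp u|)] supports are available, and [d <= #|supp u|]. *)
have : (#|B| <= #|powerset (~: supp u)|)%N.
  rewrite -(card_in_imset injB); apply/subset_leq_card/fintype.subsetP.
  by move=> _ /imsetP [E _ ->]; rewrite powersetE; apply: subsetDr.
rewrite card_powerset [#|~: _|]cardsCs finset.setCK card_ord => leB.
have leN : (#|supp u| <= N)%N by rewrite -[X in (_ <= X)%N]card_ord max_card.
apply: leq_trans (leq_mul leB (leqnn _)) _.
by rewrite -expnD leq_pexp2l // -[X in (_ <= X)%N](subnK leN) leq_add2l.
Qed.

End StabilizerGroups.

(** * Positivity of the Hilbert-Schmidt form *)

Section Adjoint.
Variable C : numClosedFieldType.

Lemma adjmx_mul m n p (A : 'M[C]_(m, n)) (B : 'M[C]_(n, p)) :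
  (A *m B)^t* = B^t* *m A^t*.
Proof. by rewrite trmx_mul map_mxM. Qed.

Lemma mxtrace_mul_adj m n (A : 'M[C]_(m, n)) :
  \tr (A *m A^t*) = \sum_i \sum_j `|A i j| ^+ 2.
Proof.
by apply: eq_bigr => i _; rewrite mxE; apply: eq_bigr => j _; rewrite !mxE normCK.
Qed.

Lemma mxtrace_mul_adj_ge0 m n (A : 'M[C]_(m, n)) : 0 <= \tr (A *m A^t*).
Proof.
rewrite mxtrace_mul_adj sumr_ge0 // => i _; rewrite sumr_ge0 // => j _.
by rewrite exprn_ge0.
Qed.

Lemma mxtrace_mul_adj_eq0 m n (A : 'M[C]_(m, n)) : \tr (A *m A^t*) = 0 -> A = 0.
Proof.
have sq_ge0 i j : 0 <= `|A i j| ^+ 2 by rewrite exprn_ge0.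
rewrite mxtrace_mul_adj => /eqP; rewrite psumr_eq0; last first.
  by move=> i _; rewrite sumr_ge0.
move=> /allP A0; apply/matrixP => i j; rewrite mxE.
have /eqP := A0 i (mem_index_enum i) => /eqP; rewrite /= psumr_eq0 //.
by move=> /allP /(_ j (mem_index_enum j)); rewrite /= expf_eq0 normr_eq0 => /eqP.
Qed.

End Adjoint.

(** * Density matrices and existence of stabilizer states *)

Section StabilizerStates.
Variables (R : realType) (N : nat).
Implicit Types (u v : label N) (E F H : pauli_string N) (G S : {set pauli_string N}).
Implicit Types (psi : ket R N).

(** For a stabilizer group of order [2 ^ N] this is the average over the group, that is, the
    projector onto its common fixed vectors. *)
Definition stab_proj G : operator R N := (2 ^+ N)^-1 *: \sum_(E in G) pauli_op R E.

Lemma stab_proj_adj G : (stab_proj G)^t* = stab_proj G.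
Proof.
rewrite /stab_proj linearZ /= map_mxZ fmorphV rmorphXn rmorph_nat; congr (_ *: _).
by rewrite raddf_sum raddf_sum; apply: eq_bigr => E _; exact: pauli_op_adj.
Qed.

Lemma stab_proj_fix G psi : #|G| = (2 ^ N)%N ->
  (forall E, E \in G -> pauli_op R E *m psi = psi) -> stab_proj G *m psi = psi.
Proof.
move=> cG fix_psi; rewrite /stab_proj -scalemxAl mulmx_suml (eq_bigr (fun=> psi)) //.
rewrite sumr_const cG -[psi *+ _]scaler_nat scalerA natrX mulVf ?scale1r //.
by rewrite expf_neq0 // pnatr_eq0.
Qed.

(** The Hilbert-Schmidt distance vanishes: [rho *m rho], [P *m P] and both mixed products have trace
    1. *)
Lemma pure_state_stab_proj G psi :
    stab_group G -> #|G| = (2 ^ N)%N -> normalized psi ->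
    (forall E, E \in G -> pauli_op R E *m psi = psi) ->
  pure_state psi = stab_proj G.
Proof.
move=> sG cG npsi fix_psi; set P := stab_proj G; set rho := pure_state psi.
have n0 : (2 ^+ N : R[i]) != 0 by rewrite expf_neq0 // pnatr_eq0.
have Ppsi : P *m psi = psi by exact: stab_proj_fix.
have rhoA : rho^t* = rho by rewrite /rho /pure_state adjmx_mul trmxCK.
have Prho : P *m rho = rho by rewrite mulmxA Ppsi.
have rhoP : rho *m P = rho.
  by have := adjmx_mul P rho; rewrite Prho stab_proj_adj rhoA.
have tr_rho : \tr rho = 1.
  by rewrite /rho /pure_state mxtrace_mulC npsi mxtrace1.
have rho2 : rho *m rho = rho.
  by rewrite /rho /pure_state mulmxA -[psi *m _ *m _]mulmxA npsi mulmx1.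
(* Distinct strings of [G] have distinct labels, so only the [2 ^ N] pairs with [F = E] contribute,
   each [2 ^ N]. *)
have trPP : \tr (P *m P) = 1.
  rewrite /P /stab_proj -scalemxAl -scalemxAr !linearZ /= mulmx_suml raddf_sum /=.
  rewrite (eq_bigr (fun=> 2 ^+ N)) => [|E EG].
    by rewrite sumr_const cG -[_ *+ (2 ^ N)%N]mulr_natr natrX mulKf // mulVf.
  rewrite mulmx_sumr raddf_sum (bigD1 E) //= pauli_op_trM eqxx addbb expr0 mul1r.
  rewrite big1 ?addr0 // => F /andP [FG FE]; rewrite pauli_op_trM; case: eqP => // eEF.
  case/eqP: FE; case: E F EG FG eEF => [b u] [c v] /= EG FG uv.
  by rewrite uv in EG *; rewrite (stab_group_sign sG EG FG).
apply/esym/eqP; rewrite -subr_eq0; apply/eqP/mxtrace_mul_adj_eq0.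
rewrite linearB /= map_mxB stab_proj_adj rhoA mulmxBl !mulmxBr Prho rhoP rho2.
by rewrite !linearB /= trPP tr_rho !addrN addr0.
Qed.

(** Left multiplication by a string of [G] permutes [G], so every column of the sum [M] is fixed.
    Only the identity contributes to the trace of [M], which is thus nonzero; a nonzero column is
    normalized. *)
Lemma stab_state_exists G : stab_group G ->
  exists2 psi, normalized psi & forall E, E \in G -> pauli_op R E *m psi = psi.
Proof.
move=> [G1 N1 GC GM]; set M : operator R N := \sum_(E in G) pauli_op R E.
have fixM E : E \in G -> pauli_op R E *m M = M.
  move=> EG; rewrite mulmx_sumr.
  rewrite [RHS](reindex_onto (string_mul E) (string_mul E)) /= => [|F FG]; last first.
    by rewrite (string_mulK R) ?GC.
  apply: eq_big => [F|F FG]; last by rewrite pauli_opM ?GC.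
  apply/idP/andP => [FG|[EFG /eqP <-]]; last exact: GM.
  by rewrite GM // (string_mulK R) ?GC.
have trM : \tr M = 2 ^+ N.
  rewrite raddf_sum (bigD1 ((false, 0) : pauli_string N)) //= pauli_op_tr eqxx expr0 mul1r.
  rewrite big1 ?addr0 // => -[b u] /andP [EG E0]; rewrite pauli_op_tr /=.
  case: eqP => // u0; move: EG E0; rewrite u0; case: b => [|_]; rewrite ?eqxx //.
  by rewrite (negPf N1).
have [j Mj] : exists j, col j M != 0.
  apply/existsP; apply: contraT => /existsPn M0.
  have : \tr M = 0.
    apply: big1 => i _; have /negPn/eqP/colP/(_ i) := M0 i.
    by rewrite !mxE.
  by move/eqP; rewrite trM expf_eq0 pnatr_eq0 andbF.
set v := col j M; pose c := \tr (v *m v^t*).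
have c_gt0 : 0 < c.
  rewrite lt_def mxtrace_mul_adj_ge0 andbT; apply: contra Mj => /eqP c0.
  exact/eqP/mxtrace_mul_adj_eq0.
exists ((sqrtC c)^-1 *: v).
  rewrite /normalized [(_ *: v)^T]linearZ /= map_mxZ -scalemxAl -scalemxAr scalerA.
  have -> : v^t* *m v = c%:M.
    by rewrite [LHS]mx11_scalar -trace_mx11 mxtrace_mulC.
  rewrite scale_scalar_mx; congr _%:M.
  rewrite fmorphV /= geC0_conj ?sqrtC_ge0 ?ltW // -invfM -expr2 sqrtCK mulVf //.
  by rewrite gt_eqF.
move=> E EG; rewrite -scalemxAr; congr (_ *: _).
by rewrite /v !colE mulmxA fixM.
Qed.

End StabilizerStates.

(** * Entropy from the spectrum *)

Section Entropy.
Variable R : realType.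

Lemma log2_1 : log2 (1 : R) = 0.
Proof. by rewrite /log2 ln1 mul0r. Qed.

Lemma log2_le (d : nat) (x : R) : 0 < x -> x * 2 ^+ d <= 1 -> log2 x <= - d%:R.
Proof.
move=> x0 xd; have ln2 : 0 < ln 2 :> R by rewrite ln_gt0 // ltr1n.
have d0 : (0 : R) < 2 ^+ d by rewrite exprn_gt0.
have : ln (x * 2 ^+ d) <= 0 by rewrite ln_le0.
rewrite lnM ?posrE // lnXn // /log2 ler_pdivrMr // mulNr -[_ *+ d]mulr_natl.
by lra.
Qed.

(** The diagonalizing matrices cancel under the trace, and since the logarithms are real, the real
    part falls on the other factor. *)
Lemma von_neumann_entropyE n (A : 'M[R[i]]_n) : A \is normalmx ->
  von_neumann_entropy A =
  - \sum_i complex.Re (spectral_diag A 0 i) * log2 (complex.Re (spectral_diag A 0 i)).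
Proof.
move=> /orthomx_spectralP eA; have uP := spectral_unit A.
rewrite /von_neumann_entropy {1}eA /mx_log2.
rewrite -!mulmxA mxtrace_mulC -!mulmxA mulKVmx // mulmxV // mulmx1.
rewrite mul_diag_mx.
have ReD : {morph @complex.Re R : x y / x + y >-> x + y} by move=> [a b] [c e].
have ReN x : complex.Re (- x) = - complex.Re x :> R by case: x.
rewrite ReN /mxtrace (big_morph _ ReD (erefl _)).
congr (- _); apply: eq_bigr => i _; rewrite !mxE eqxx mulr1n.
by case: (spectral_diag A 0 i) => a b; simpc.
Qed.

Lemma spectral_diag_eigen n (A : 'M[R[i]]_n) i : A \is normalmx ->
  exists2 v : 'rV[R[i]]_n, v != 0 & v *m A = spectral_diag A 0 i *: v.
Proof.
move=> /orthomx_spectralP eA; have uP := spectral_unit A.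
exists (row i (spectralmx A)).
  apply/eqP => /(congr1 (mulmx^~ (invmx (spectralmx A)))).
  rewrite -row_mul mulmxV // mul0mx => /rowP /(_ i); rewrite !mxE eqxx => /eqP.
  by rewrite oner_eq0.
rewrite {2}eA !mulmxA -row_mul mulmxV // row1 -rowE row_diag_mx -scalemxAl.
by rewrite -rowE.
Qed.

Lemma spectral_diag_sum n (A : 'M[R[i]]_n) : A \is normalmx ->
  \sum_i spectral_diag A 0 i = \tr A.
Proof.
move=> /orthomx_spectralP eA; have uP := spectral_unit A.
by rewrite {2}eA -mulmxA mxtrace_mulC mulmxK // mxtrace_diag.
Qed.

(** The eigenvalues are 0 and 1, where [x * log2 x] vanishes. *)
Lemma entropy_idempotent n (A : 'M[R[i]]_n) :
  A^t* = A -> A *m A = A -> von_neumann_entropy A = 0.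
Proof.
move=> Ah AA; have nA : A \is normalmx by apply/normalmxP; rewrite Ah.
rewrite von_neumann_entropyE // big1 ?oppr0 // => i _.
set l := spectral_diag A 0 i; have [v v0 vA] := spectral_diag_eigen i nA.
have /eqP : l *: v - (l * l) *: v = 0.
  by rewrite -scalerA -vA scalemxAl -vA -mulmxA AA subrr.
rewrite -scalerBl scaler_eq0 (negPf v0) orbF -{1}[l]mulr1 -mulrBr mulf_eq0.
rewrite subr_eq0 [1 == _]eq_sym => /orP [] /eqP -> /=; first by rewrite mul0r.
by rewrite log2_1 mulr0.
Qed.

(** Entropy is at least min-entropy. The spectrum need not be matched with [p] as a list: it
    suffices that each eigenvalue is some entry of [p] and that the eigenvalues sum to the trace
    1. *)
Lemma entropy_ge n (U : 'M[R[i]]_n) (p : 'rV[R[i]]_n) (d : nat) :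
    U^t* *m U = 1%:M ->
    (forall j, 0 <= p 0 j) -> (forall j, p 0 j * 2 ^+ d <= 1) ->
    \sum_j p 0 j = 1 ->
  d%:R <= von_neumann_entropy (U *m diag_mx p *m U^t*).
Proof.
move=> UU p0 pd p1; set A := _ *m _.
have [uU' uU] := mulmx1_unit UU.
have Ah : A^t* = A.
  have dh : (diag_mx p)^t* = diag_mx p.
    apply/matrixP => i j; rewrite !mxE eq_sym rmorphMn /= geC0_conj //.
    by case: eqP => [->|]; rewrite ?mulr0n.
  by rewrite /A adjmx_mul trmxCK adjmx_mul dh mulmxA.
have nA : A \is normalmx by apply/normalmxP; rewrite Ah.
set l := spectral_diag A.
(* For a left eigenvector [v], the row [v *m U] is an eigenvector of [diag_mx p]; a nonzero
   coordinate identifies the eigenvalue. *)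
have l_p i : exists j, l 0 i = p 0 j.
  have [v v0 vA] := spectral_diag_eigen i nA.
  have vU0 : v *m U != 0 by apply: contraNneq v0 => vU; rewrite -[v](mulmxK uU) vU mul0mx.
  have [j vUj] : exists j, (v *m U) 0 j != 0.
    apply/existsP; apply: contraNT vU0 => /existsPn vU0.
    by apply/eqP/rowP => j; rewrite [RHS]mxE; apply/eqP/negPn.
  exists j; apply: (mulfI vUj); rewrite mulrC.
  have : (v *m A *m U) 0 j = (l 0 i *: v *m U) 0 j by rewrite vA.
  rewrite /A !mulmxA -[_ *m _ *m U]mulmxA UU mulmx1 mul_mx_diag mxE.
  by rewrite -scalemxAl [in RHS]mxE => ->.
have suml : \sum_i l 0 i = 1.
  rewrite spectral_diag_sum // /A mxtrace_mulC mulmxA UU mul1mx mxtrace_diag.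
  exact: p1.
have ReD : {morph @complex.Re R : x y / x + y >-> x + y} by move=> [a b] [c e].
have Re1 : \sum_i complex.Re (l 0 i) = 1.
  by rewrite -[RHS]/(complex.Re 1) -suml (big_morph _ ReD (erefl _)).
(* The bound [d] is written as [d] times the sum of the eigenvalues and compared term by term. *)
rewrite von_neumann_entropyE // -sumrN -[d%:R]mulr1 -[X in _ * X]Re1 mulr_sumr.
apply: ler_sum => i _; have [j ->] := l_p i.
have pE : p 0 j = (complex.Re (p 0 j))%:C by rewrite RRe_real // ger0_real.
have := p0 j; have := pd j; rewrite pE; set x := complex.Re _ => /=.
have -> : 2 ^+ d = (2 ^+ d)%:C :> R[i] by rewrite rmorphXn rmorph_nat.
rewrite -rmorphM lecR ler0c => xd; rewrite le_eqVlt => /orP [/eqP <-|x0].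
  by rewrite mul0r mulr0 oppr0.
by rewrite mulrC -mulrN ler_pM2l // lerNr; exact: log2_le.
Qed.

End Entropy.

(** * Measurement in the local Pauli basis *)

Section Measurement.
Variables (R : realType) (N : nat) (D : local_pauli_basis R N).
Implicit Types (E F : pauli_string N) (G : {set pauli_string N}).
Local Notation site i := (site_pauli i (basis_pauli D i)).

Lemma basis_eigen_adj s i :
  (basis_ket D s)^t* *m pauli_op R (site i) = (-1) ^+ (s i) *: (basis_ket D s)^t*.
Proof.
rewrite -[pauli_op _ _]pauli_op_adj -adjmx_mul basis_eigen linearZ /= map_mxZ.
by rewrite rmorphXn rmorphN1.
Qed.

(** Kets with different bits at [i] belong to opposite eigenvalues of the same Hermitian one-site
    operator. *)
Lemma basis_ket_orthonormal s t :
  (basis_ket D s)^t* *m basis_ket D t = (s == t)%:R%:M.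
Proof.
case: (eqVneq s t) => [->|st]; first exact: basis_normalized.
have [i sti] : exists i, s i != t i.
  apply/existsP; apply: contraNT st => /existsPn st.
  by apply/eqP/ffunP=> i; apply/eqP/negPn.
set x := _ *m _.
have /eqP : (-1) ^+ (s i) *: x = (-1) ^+ (t i) *: x.
  by rewrite /x scalemxAl -basis_eigen_adj -mulmxA basis_eigen scalemxAr.
rewrite -subr_eq0 -scalerBl scaler_eq0 => /orP [|/eqP ->]; last first.
  by apply/matrixP=> a b; rewrite !mxE mul0rn.
move: sti; case: (s i) (t i) => [[|[|]]] // ? [[|[|]]] // ? _.
  by rewrite expr0 expr1 opprK -mulr2n pnatr_eq0.
by rewrite expr0 expr1 -opprD -mulr2n oppr_eq0 pnatr_eq0.
Qed.

(** At some site [E] anticommutes with the basis Pauli, of which the ket is an eigenvector; moving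
    that Pauli across [E] equates the expectation with its negative. *)
Lemma basis_expectation_eq0 s E : E.2 \notin basis_labels (basis_pauli D) ->
  (basis_ket D s)^t* *m pauli_op R E *m basis_ket D s = 0.
Proof.
rewrite inE negb_forall => eE.
have [i /norP [E0 Ea]] := existsP eE.
have ac : anticomm E.2 (site i).2.
  rewrite anticomm_site; move: E0 Ea (basis_pauli_neq D i).
  by case: (E.2 i); case: (basis_pauli D i); rewrite ?eqxx.
set k := basis_ket D s; set A := pauli_op R (site i); set x := _ *m k.
have xl : k^t* *m A *m (pauli_op R E *m k) = (-1) ^+ (s i) *: x.
  by rewrite basis_eigen_adj -scalemxAl mulmxA.
have xr : k^t* *m pauli_op R E *m (A *m k) = (-1) ^+ (s i) *: x.
  by rewrite basis_eigen -scalemxAr.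
have AE : A *m pauli_op R E = - (pauli_op R E *m A).
  by rewrite pauli_op_anticomm ac expr1 scaleN1r.
have /eqP : (-1) ^+ (s i) *: x = - ((-1) ^+ (s i) *: x).
  rewrite -{1}xl -xr !mulmxA -[k^t* *m A *m _]mulmxA AE.
  by rewrite mulmxN mulNmx !mulmxA.
rewrite -subr_eq0 opprK -mulr2n -scaler_nat !scaler_eq0 pnatr_eq0 signr_eq0.
by move/eqP.
Qed.

(** As [1 - E] squares to twice itself, [2 * (1 - <E>)] is a squared norm. *)
Lemma normalized_expectation_le1 (k : ket R N) E : normalized k ->
  \tr (k^t* *m pauli_op R E *m k) <= 1.
Proof.
move=> nk; have := mxtrace_mul_adj_ge0 (k^t* *m (1%:M - pauli_op R E)).
have sq : (1%:M - pauli_op R E) *m (1%:M - pauli_op R E) =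
    2 *: (1%:M - pauli_op R E) :> operator R N.
  by rewrite mulmxBl !mulmxBr !mulmx1 !mul1mx pauli_op_sqr opprB scaler_nat mulr2n.
rewrite adjmx_mul trmxCK [(_ - _)^T]linearB /= map_mxB trmx1 map_mx1 pauli_op_adj.
rewrite mulmxA -[k^t* *m _ *m _]mulmxA sq -scalemxAr -scalemxAl linearZ /=.
rewrite pmulr_rge0 ?ltr0n // mulmxBr mulmxBl mulmx1 linearB /= nk mxtrace1.
by rewrite subr_ge0.
Qed.

Lemma basis_probability_le G s :
  \tr ((basis_ket D s)^t* *m stab_proj R G *m basis_ket D s) * 2 ^+ N
    <= #|[set E in G | E.2 \in basis_labels (basis_pauli D)]|%:R.
Proof.
rewrite /stab_proj -scalemxAr -scalemxAl linearZ /= mulrC mulVKf; last first.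
  by rewrite expf_neq0 // pnatr_eq0.
rewrite mulmx_sumr mulmx_suml raddf_sum /=.
rewrite (bigID (fun E => E.2 \in basis_labels (basis_pauli D))) /=.
rewrite [X in _ + X]big1 ?addr0 => [|E /andP [_ /basis_expectation_eq0 ->]]; last first.
  by rewrite linear0.
rewrite -[_%:R]sumr_const.
under [leRHS]eq_bigl => E do rewrite finset.in_set.
by apply: ler_sum => E _; exact/normalized_expectation_le1/basis_normalized.
Qed.

Definition basis_mx : operator R N :=
  \matrix_(x, y) basis_ket D (enum_val y : bits N) x 0.

Definition outcome_probs (rho : operator R N) : 'rV[R[i]]_(hdim N) :=
  \row_y let k := basis_ket D (enum_val y : bits N) in \tr (k^t* *m rho *m k).

Lemma basis_mx_unitary : basis_mx^t* *m basis_mx = 1%:M.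
Proof.
apply/matrixP => x y; rewrite !mxE -(inj_eq enum_val_inj).
have /matrixP /(_ 0 0) := basis_ket_orthonormal (enum_val x) (enum_val y).
rewrite !mxE eqxx mulr1n => <-.
by apply: eq_bigr => z _; rewrite !mxE.
Qed.

Lemma dephase_diag (rho : operator R N) :
  dephase D rho = basis_mx *m diag_mx (outcome_probs rho) *m basis_mx^t*.
Proof.
apply/matrixP => x y; rewrite /dephase summxE mxE /=.
rewrite (reindex (@enum_val _ (mem {: bits N}))) /=; last first.
  by apply: onW_bij; exact: enum_val_bij.
apply: eq_bigr => z _; rewrite mul_mx_diag !mxE big_ord1 !mxE.
by rewrite mulrA [X in X * _]mulrC.
Qed.

Lemma sum_outcome_probs (rho : operator R N) :
  \sum_j outcome_probs rho 0 j = \tr rho.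
Proof.
have -> : \tr rho = \tr (basis_mx^t* *m rho *m basis_mx).
  by rewrite mxtrace_mulC mulmxA (mulmx1C basis_mx_unitary) mul1mx.
apply: eq_bigr => y _; rewrite mxE /= trace_mx11 !mxE.
apply: eq_bigr => z _; rewrite !mxE; congr (_ * _).
by apply: eq_bigr => w _; rewrite !mxE.
Qed.

(** A pure state has entropy 0, so the coherence is the entropy of the outcomes; the count of
    diagonal strings bounds each probability by [2 ^- d]. *)
Lemma coherence_stab_ge G (psi : ket R N) (d : nat) :
    normalized psi -> pure_state psi = stab_proj R G ->
    (#|[set E in G | E.2 \in basis_labels (basis_pauli D)]| * 2 ^ d <= 2 ^ N)%N ->
  d%:R <= coherence (pure_state psi) D.
Proof.
move=> npsi pureG cB; rewrite /coherence [X in _ - X]entropy_idempotent; last 2 first.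
- by rewrite /pure_state adjmx_mul trmxCK.
- by rewrite /pure_state mulmxA -[psi *m _ *m _]mulmxA npsi mulmx1.
rewrite subr0 dephase_diag; apply: entropy_ge.
- exact: basis_mx_unitary.
- move=> j; rewrite mxE /= /pure_state mulmxA -mulmxA.
  set k := basis_ket D _.
  have -> : psi^t* *m k = (k^t* *m psi)^t* by rewrite adjmx_mul trmxCK.
  exact: mxtrace_mul_adj_ge0.
- move=> j; rewrite mxE /= pureG.
  have n0 : (0 : R[i]) < 2 ^+ N by rewrite exprn_gt0.
  rewrite -(ler_pM2r n0) mul1r mulrAC.
  apply: le_trans (ler_wpM2r _ (basis_probability_le G (enum_val j))) _.
    by rewrite exprn_ge0.
  by rewrite -!natrX -natrM ler_nat.
- by rewrite sum_outcome_probs /pure_state mxtrace_mulC npsi mxtrace1.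
Qed.

End Measurement.

(** * Generated operator groups and sets of strings *)

Section Generated.
Variables (R : realType) (N : nat).
Implicit Types (E F : pauli_string N) (G : {set pauli_string N}).
Implicit Types (psi : ket R N) (X : set (operator R N)).

Lemma generated1 X : generated X 1%:M.
Proof. by move=> H [[]]. Qed.

Lemma generatedM X A B : generated X A -> generated X B -> generated X (A *m B).
Proof.
move=> gA gB H HX; have [[_ _ HM _] _] := HX.
by apply: HM; [exact: gA|exact: gB].
Qed.

(** A generated group is an intersection of groups, so a property spreads from the generators to all
    elements once it cuts out a group of invertible matrices. *)
Lemma centralizer_group (B : operator R N) :
  mx_group [set A : operator R N | A \in unitmx /\ comm_mx B A].
Proof.
split=> /=.
- by move=> A [].
- by rewrite unitmx1; split=> //; exact: comm_mx1.
- move=> A A' [uA BA] [uA' BA']; rewrite unitmx_mul uA uA'; split=> //.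
  exact: comm_mxM.
- move=> A [uA BA]; rewrite unitmx_inv; split=> //.
  rewrite /comm_mx in BA *.
  by rewrite -{2}[B](mulmxK uA) BA !mulmxA mulVmx // mul1mx.
Qed.

Lemma fixer_group psi :
  mx_group [set A : operator R N | A \in unitmx /\ A *m psi = psi].
Proof.
split=> /=.
- by move=> A [].
- by rewrite unitmx1 mul1mx.
- move=> A A' [uA Apsi] [uA' A'psi]; rewrite unitmx_mul uA uA' -mulmxA A'psi.
  by split.
- by move=> A [uA Apsi]; rewrite unitmx_inv -{1}Apsi mulKmx.
Qed.

Lemma mx_group_stab_group G :
  let GO := [set pauli_op R E | E in [set` G]]%classic in
  mx_group GO -> (forall A B, GO A -> GO B -> comm_mx A B) -> ~ GO (- 1%:M) ->
  stab_group G.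
Proof.
move=> GO [_ GO1 GOM _] GOC GON.
have inG E : GO (pauli_op R E) -> E \in G by case=> F /= FG /pauli_op_inj <-.
have GC : {in G &, forall E F, ~~ anticomm E.2 F.2}.
  by move=> E F EG FG; apply/(pauli_op_comm R)/GOC; [exists E|exists F].
split=> //.
- by apply: inG; rewrite pauli_op1.
- by apply/negP => NG; apply: GON; exists (true, 0); rewrite // -pauli_op1 -pauli_opN.
- move=> E F EG FG; apply: inG; rewrite -pauli_opM ?GC //.
  by apply: GOM; [exists E|exists F].
Qed.

Lemma stab_group_mx_group G : stab_group G ->
  let GO := [set pauli_op R E | E in [set` G]]%classic in
  [/\ mx_group GO, forall A B, GO A -> GO B -> comm_mx A B & ~ GO (- 1%:M)].
Proof.
move=> [G1 N1 GC GM] GO; split; first split.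
- by move=> _ [E _ <-] /=; exact: pauli_op_unit.
- by exists (false, 0); rewrite ?pauli_op1.
- move=> _ _ [E EG <-] [F FG <-]; rewrite pauli_opM ?GC //.
  by exists (string_mul E F) => //; exact: GM.
- by move=> _ [E EG <-]; rewrite pauli_op_inv; exists E.
- by move=> _ _ [E EG <-] [F FG <-]; apply/pauli_op_comm/GC.
case=> E EG; rewrite -pauli_op1 -pauli_opN => /pauli_op_inj eE.
by move: N1; rewrite /= -eE EG.
Qed.

End Generated.

(** * The stabilizer group of the code *)

Section StabilizerCode.
Variables (R : realType) (N k d : nat) (P : stabilizer_code R N k d).
Implicit Types (E F : pauli_string N) (psi : ket R N).
Local Notation gen := (pauli_generated (code_gen P) setT : set (operator R N)).

Definition code_strings : {set pauli_string N} :=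
  [set E | `[< gen (pauli_op R E) >]].

Lemma code_stringsP E : E \in code_strings <-> gen (pauli_op R E).
Proof. by rewrite inE; split=> [/asboolP|/asboolP]. Qed.

Lemma code_gen_strings j : code_gen P j \in code_strings.
Proof. by apply/code_stringsP; apply: sub_gen_smallest; exists j. Qed.

Lemma code_generated_comm (B : operator R N) :
  (forall j, comm_mx B (pauli_op R (code_gen P j))) ->
  forall A, gen A -> comm_mx B A.
Proof.
move=> BC A /(smallest_sub (centralizer_group B)) [] // _ [j _ <-] /=.
by split; [exact: pauli_op_unit|exact: BC].
Qed.

Lemma code_space_fix psi E :
  psi \in code_space P -> E \in code_strings -> pauli_op R E *m psi = psi.
Proof.
move=> /code_spaceP fix_psi /code_stringsP.
case/(smallest_sub (fixer_group psi)) => // _ [j _ <-] /=.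
by split; [exact: pauli_op_unit|exact: fix_psi].
Qed.

Lemma code_stab_group : stab_group code_strings.
Proof.
have SC : {in code_strings &, forall E F, ~~ anticomm E.2 F.2}.
  move=> E F /code_stringsP ES /code_stringsP FS; apply/(pauli_op_comm R).
  (* Commutation spreads from the generators to the group in one argument, then in the other. *)
  apply: (code_generated_comm _ FS) => j; apply/comm_mx_sym.
  by apply: (code_generated_comm _ ES) => i; exact: code_comm.
split=> //.
- by apply/code_stringsP; rewrite pauli_op1; exact: generated1.
- apply/negP => /code_stringsP; rewrite (pauli_opN R false) pauli_op1.
  exact: code_noN1.
- move=> E F ES FS; apply/code_stringsP; rewrite -pauli_opM ?SC //.
  by apply: generatedM; apply/code_stringsP.
Qed.

Lemma code_distance_le u :
    u \in perp (labels code_strings) -> u \notin labels code_strings ->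
  (d <= weight (false, u))%N.
Proof.
move=> /perpP up nuS; have [_ dmin] := code_distance P.
apply: dmin; split.
- apply: code_generated_comm => j; apply/pauli_op_comm/up/labelsP.
  by exists (code_gen P j); first exact: code_gen_strings.
- move/code_stringsP => uS; case/negP: nuS; apply/labelsP.
  by exists (false, u).
- rewrite -pauli_opN => /code_stringsP uS; case/negP: nuS; apply/labelsP.
  by exists (true, u).
Qed.

(** With [2 ^ N] elements, the group would have a pure state as its projector, which fixes every
    code vector; the code space would lie in a line, although [2 ^ k >= 2]. *)
Lemma code_strings_lt : (1 <= k)%N -> (#|code_strings| < 2 ^ N)%N.
Proof.
move=> k1; have sS := code_stab_group.
rewrite ltn_neqAle stab_group_card // andbT; apply/eqP => cS.
have [psi npsi fix_psi] := stab_state_exists R sS.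
have sub : (code_space P <= <[psi]>)%VS.
  apply/subvP => v vP; apply/vlineP; exists ((psi^t* *m v) 0 0).
  rewrite -{1}(stab_proj_fix cS (fun E => code_space_fix vP)).
  rewrite -(pure_state_stab_proj sS cS npsi fix_psi) /pure_state -mulmxA.
  by rewrite {1}[_ *m v]mx11_scalar mul_mx_scalar.
have := dimvS sub; rewrite code_dim dim_vline.
have : (2 ^ 1 <= 2 ^ k)%N by rewrite leq_pexp2l.
by case: (psi != 0); lia.
Qed.

End StabilizerCode.

Theorem theorem3 (R : realType) (N k d : nat) (P : stabilizer_code R N k d)
    (D : local_pauli_basis R N) (hk : (1 <= k)%N) :
  exists2 CPD : R, is_maximum (stabilizer_coherences P D) CPD & d%:R <= CPD.
Proof.
set S := code_strings P; have sS : stab_group S := code_stab_group P.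
have a0 := basis_pauli_neq D; have iT : basis_labels (basis_pauli D) \subset perp (basis_labels (basis_pauli D)).
  by rewrite basis_labels_perp.
(* The diagonal strings of [G] all lie in [S], so the bound of [card_diag_stab] for [S] carries over
   to [G]. *)
have [G [SG sG cG GT]] :=
  stab_group_complete R sS (basis_labels_subspace (basis_pauli D)) iT.
have [psi npsi fix_psi] := stab_state_exists R sG.
have psiP : psi \in code_space P.
  apply/code_spaceP => j; apply/fix_psi/(fintype.subsetP SG).
  exact: code_gen_strings.
have psi_stab : stabilizer_state psi.
  split=> //; exists G; have [gG cmG nG] := stab_group_mx_group R sG.
  by split=> // _ [E EG <-]; exact: fix_psi.
have pureG := pure_state_stab_proj sG cG npsi fix_psi.
have psi_ge : d%:R <= coherence (pure_state psi) D.
  apply: (coherence_stab_ge npsi pureG).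
  have := card_diag_stab a0 sS (code_strings_lt P hk) (@code_distance_le _ _ _ _ P).
  apply: leq_trans.
  rewrite leq_mul2r; apply/orP; right; apply/subset_leq_card.
  apply/fintype.subsetP => E; rewrite finset.in_set => /andP [EG ET].
  by rewrite finset.in_set (GT E EG ET).
(* The coherence depends on the state only through [stab_proj R H], and [H] ranges over a finite
   type, so a maximizing [H] exists. *)
pose K (H : {set pauli_string N}) := `[< exists phi,
  [/\ phi \in code_space P, stabilizer_state phi & pure_state phi = stab_proj R H] >].
have KG : K G by apply/asboolP; exists psi.
pose f H := coherence (stab_proj R H) D.
have [H /asboolP [phi [phiP phi_stab pureH]] Hmax] := arg_maxP f KG.
exists (f H); last by apply: le_trans psi_ge _; rewrite pureG; exact: Hmax.
split; first by exists phi; [split | rewrite pureH].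
move=> _ [chi [chiP chi_stab] <-]; have [nchi [H' [cH gH' cmH' nH' fixH']]] := chi_stab.
have pureH' : pure_state chi = stab_proj R H'.
  apply: pure_state_stab_proj => //; first exact: mx_group_stab_group gH' cmH' nH'.
  by move=> E EH'; apply: fixH'; exists E.
by rewrite pureH'; apply: Hmax; apply/asboolP; exists chi.
Qed.
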